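(* Let $M$ be an o-minimal structure, and let $$1\longrightarrow A \stackrel{\iota}{\longrightarrow} B \stackrel{\beta}{\longrightarrow} C \longrightarrow 1$$ be a short exact sequence of groups that is $\emptyset$-definable in $M$ (the groups and the homomorphisms are $\emptyset$-definable), where $\iota$ is the inclusion map and $A$ is definably connected. Then, for every finite abelian group $Z$ that is $\emptyset$-definable in $M$, the sequence $$0\longrightarrow H^2_d(C,Z) \stackrel{\beta_d^*}{\longrightarrow} H^2_d(B,Z) \stackrel{\iota_d^*}{\longrightarrow} H^2_d(A,Z)$$ is exact, where $\iota_d^*([f]) = [f|_{A\times A}]$ is the restriction map and $\beta_d^*([g]) = [g\circ (\beta\times \beta)]$ is the inflation map.
   Context: An o-minimal structure $M$ expands a dense linear order without endpoints. A group is $\emptyset$-definable in $M$ if its underlying set and operation are definable in $M$ without parameters. A definable group is definably connected if it has no proper definable subgroup of finite index. A finite group can always be made $\emptyset$-definable by naming its elements. For a group $G$ and a finite abelian group $Z$ (written additively), a ($Z$-valued) 2-cocycle is a map $f:G\times G\to Z$ with $f(x,1)=0=f(1,x)$ and $f(x,y)+f(xy,z)=f(x,yz)+f(y,z)$ for all $x,y,z$. For $h:G\to Z$ with $h(1)=0$ put $dh(x,y)=h(xy)-h(x)-h(y)$. If $G$ and $Z$ are $\emptyset$-definable in $M$, let $Z^2_d(G,Z)$ be the group (under pointwise addition) of $\emptyset$-definable 2-cocycles and $B^2_d(G,Z)$ the subgroup of those of the form $dh$ for some $\emptyset$-definable $h:G\to Z$ with $h(1)=0$. Then $H^2_d(G,Z)=Z^2_d(G,Z)/B^2_d(G,Z)$.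 *)

(* Defs.v *)
From HB Require Import structures.
From mathcomp Require Import all_boot all_order all_algebra.
From mathcomp Require Import mathcomp_extra boolp classical_sets functions.
From mathcomp Require Import cardinality.

Set Implicit Arguments.
Unset Strict Implicit.
Unset Printing Implicit Defensive.

Import Order.TTheory GRing.Theory.
Local Open Scope classical_set_scope.
Local Open Scope ring_scope.
Local Open Scope quotient_scope.

Record language := Language {
  fsym : Type; farity : fsym -> nat;
  rsym : Type; rarity : rsym -> nat }.

(* The order symbol is not part of [lang]: it is a logical symbol (see [FLt]),
   always interpreted by the order of the universe. *)
Record structure := Structure {
  lang : language;
  disp : Order.disp_t;
  univ :> orderType disp;
  fint : forall f : fsym lang, (farity f).-tuple univ -> univ;
  rint : forall r : rsym lang, set ((rarity r).-tuple univ) }.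

(* Terms and formulas in the free variables 0, ..., n-1; [FEx] binds variable 0
   and shifts the others by one. *)
Inductive term (L : language) (n : nat) : Type :=
| Var of 'I_n
| App (f : fsym L) of ('I_(farity f) -> term L n).
Arguments Var {L n}.

Inductive formula (L : language) : nat -> Type :=
| FEq n of term L n & term L n : formula L n
| FLt n of term L n & term L n : formula L n
| FRel n (r : rsym L) of ('I_(rarity r) -> term L n) : formula L n
| FNot n of formula L n : formula L n
| FAnd n of formula L n & formula L n : formula L n
| FEx n of formula L n.+1 : formula L n.

Definition tcat (T : Type) m n (x : m.-tuple T) (y : n.-tuple T) :
  (m + n).-tuple T := [tuple of x ++ y].

Section Definability.
Variable M : structure.

Fixpoint eval n (x : n.-tuple M) (t : term (lang M) n) : M :=
  match t with
  | Var i => tnth x i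
  | App f ts => fint [tuple eval x (ts i) | i < farity f]
  end.

Fixpoint sat n (phi : formula (lang M) n) : n.-tuple M -> Prop :=
  match phi in formula _ n return n.-tuple M -> Prop with
  | FEq n t u => fun x => eval x t = eval x u
  | FLt n t u => fun x => (eval x t < eval x u)%O
  | FRel n r ts => fun x => rint [tuple eval x (ts i) | i < rarity r]
  | FNot n phi => fun x => ~ sat phi x
  | FAnd n phi psi => fun x => sat phi x /\ sat psi x
  | FEx n phi => fun x => exists a : M, sat phi [tuple of a :: x]
  end.

(* [definable0]: definable without parameters, i.e. over the empty set;
   [definable]: definable with parameters. *)
Definition definable0 n (S : set (n.-tuple M)) : Prop :=
  exists phi : formula (lang M) n, S = [set x | sat phi x].

Definition definable n (S : set (n.-tuple M)) : Prop :=
  exists k (a : k.-tuple M) (phi : formula (lang M) (k + n)),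
    S = [set x | sat phi (tcat a x)].

(* The members of [interval M] are the intervals, open or closed at either end,
   with endpoints in M or infinite; a point is the interval `[a, a]. *)
Definition o_minimal : Prop :=
  [/\ forall x y : M, (x < y)%O -> exists z : M, (x < z < y)%O,
      forall x : M, (exists y : M, (y < x)%O) /\ (exists y : M, (x < y)%O)
    & forall S : set (1.-tuple M), definable S ->
        exists s : seq (interval M),
          forall x : M, S [tuple x] <-> has (fun i => x \in i) s].

(* The graph of [f], where the points of its domain and codomain are identified
   with tuples of elements of M along [c] and [d]. *)
Definition graph (X Y : Type) p q (c : X -> p.-tuple M) (d : Y -> q.-tuple M)
  (f : X -> Y) : set ((p + q).-tuple M) := range (fun x => tcat (c x) (d (f x))).

Definition coord n (S : set (n.-tuple M)) : S -> n.-tuple M := \val.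

Definition coord2 n (S : set (n.-tuple M)) (x : S * S) : (n + n).-tuple M :=
  tcat (coord x.1) (coord x.2).

Definition definable0_fun n m (S : set (n.-tuple M)) (T : set (m.-tuple M))
  (f : S -> T) : Prop := definable0 (graph (@coord n S) (@coord m T) f).

Definition definable0_fun2 n m (S : set (n.-tuple M)) (T : set (m.-tuple M))
  (f : S * S -> T) : Prop := definable0 (graph (@coord2 n S) (@coord m T) f).

Definition rlift n m (r : 'I_n -> 'I_m) (i : 'I_n.+1) : 'I_m.+1 :=
  if unlift ord0 i is Some j then lift ord0 (r j) else ord0.

Fixpoint tren n m (r : 'I_n -> 'I_m) (t : term (lang M) n) : term (lang M) m :=
  match t with
  | Var i => Var (r i)
  | App f ts => App (fun i => tren r (ts i))
  end.

Fixpoint fren n (phi : formula (lang M) n) :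
    forall m, ('I_n -> 'I_m) -> formula (lang M) m :=
  match phi in formula _ n
        return forall m, ('I_n -> 'I_m) -> formula (lang M) m with
  | FEq n t u => fun m r => FEq (tren r t) (tren r u)
  | FLt n t u => fun m r => FLt (tren r t) (tren r u)
  | FRel n s ts => fun m r => FRel (fun i => tren r (ts i))
  | FNot n phi => fun m r => FNot (fren phi r)
  | FAnd n phi psi => fun m r => FAnd (fren phi r) (fren psi r)
  | FEx n phi => fun m r => FEx (fren phi (rlift r))
  end.

Lemma eval_tren n m (r : 'I_n -> 'I_m) (t : term (lang M) n) (x : m.-tuple M) :
  eval x (tren r t) = eval [tuple tnth x (r i) | i < n] t.
Proof.
elim: t => [i|f ts IH] /=; first by rewrite tnth_mktuple.
by congr fint; apply: eq_mktuple => i.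
Qed.

Lemma sat_fren n (phi : formula (lang M) n) m (r : 'I_n -> 'I_m)
    (x : m.-tuple M) :
  sat (fren phi r) x <-> sat phi [tuple tnth x (r i) | i < n].
Proof.
elim: phi m r x => {n} [n t u|n t u|n s ts|n phi IH|n phi IH psi IH'|n phi IH]
  m r x /=.
- by rewrite !eval_tren.
- by rewrite !eval_tren.
- suff -> : [tuple eval x (tren r (ts i)) | i < rarity s] =
    [tuple eval [tuple tnth x (r i) | i < n] (ts i) | i < rarity s] by [].
  by apply: eq_mktuple => i; rewrite eval_tren.
- by rewrite IH.
- by rewrite IH IH'.
- have E a : [tuple tnth [tuple of a :: x] (rlift r i) | i < n.+1] =
             [tuple of a :: [tuple tnth x (r i) | i < n]].
    apply: eq_from_tnth => i; rewrite tnth_mktuple /rlift.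
    case: unliftP => [j|] -> ; last by rewrite !tnth0.
    by rewrite !tnthS tnth_mktuple.
  by split=> -[a Ha]; exists a; move: Ha; rewrite IH E.
Qed.

Definition tlsub (T : Type) m n (w : (m + n).-tuple T) : m.-tuple T :=
  [tuple tnth w (lshift n i) | i < m].
Definition trsub (T : Type) m n (w : (m + n).-tuple T) : n.-tuple T :=
  [tuple tnth w (rshift m i) | i < n].

Lemma tlsubE (T : Type) m n (x : m.-tuple T) (y : n.-tuple T) :
  tlsub (tcat x y) = x.
Proof. by apply: eq_from_tnth => i; rewrite tnth_mktuple tnth_lshift. Qed.

Lemma trsubE (T : Type) m n (x : m.-tuple T) (y : n.-tuple T) :
  trsub (tcat x y) = y.
Proof. by apply: eq_from_tnth => i; rewrite tnth_mktuple tnth_rshift. Qed.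

Lemma tcat_sub (T : Type) m n (w : (m + n).-tuple T) :
  tcat (tlsub w) (trsub w) = w.
Proof.
apply: eq_from_tnth => i; rewrite -(fintype.splitK i); case: (fintype.split i) => j /=.
  by rewrite tnth_lshift tnth_mktuple.
by rewrite tnth_rshift tnth_mktuple.
Qed.

Lemma tcat_inj (T : Type) m n (x x' : m.-tuple T) (y y' : n.-tuple T) :
  tcat x y = tcat x' y' -> x = x' /\ y = y'.
Proof.
move=> E; split; first by rewrite -(tlsubE x y) E tlsubE.
by rewrite -(trsubE x y) E trsubE.
Qed.

Definition selection m n (p : m.-tuple M -> n.-tuple M) : Prop :=
  exists r : 'I_n -> 'I_m, forall w i, tnth (p w) i = tnth w (r i).

Lemma selection_id n : selection (fun w : n.-tuple M => w).
Proof. by exists id. Qed.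

Lemma selection_l m n k (p : m.-tuple M -> (n + k).-tuple M) :
  selection p -> selection (fun w => tlsub (p w)).
Proof.
by case=> r Hr; exists (fun i => r (lshift k i)) => w i; rewrite tnth_mktuple.
Qed.

Lemma selection_r m n k (p : m.-tuple M -> (n + k).-tuple M) :
  selection p -> selection (fun w => trsub (p w)).
Proof.
by case=> r Hr; exists (fun i => r (rshift n i)) => w i; rewrite tnth_mktuple.
Qed.

Lemma selection_cat m n k (p : m.-tuple M -> n.-tuple M)
    (q : m.-tuple M -> k.-tuple M) :
  selection p -> selection q -> selection (fun w => tcat (p w) (q w)).
Proof.
case=> r Hr [s Hs].
exists (fun i => match fintype.split i with inl j => r j | inr j => s j end) => w i.
rewrite -{1}(fintype.splitK i); case: (fintype.split i) => j /=.
  by rewrite tnth_lshift.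
by rewrite tnth_rshift.
Qed.

Lemma definable0_preim m n (p : m.-tuple M -> n.-tuple M) S :
  selection p -> definable0 S -> definable0 [set w | S (p w)].
Proof.
case=> r Hr [phi ->]; exists (fren phi r).
apply/seteqP; split=> w /=; rewrite sat_fren;
  suff -> : [tuple tnth w (r i) | i < n] = p w by [].
  by apply: eq_from_tnth => i; rewrite tnth_mktuple Hr.
by apply: eq_from_tnth => i; rewrite tnth_mktuple Hr.
Qed.

Lemma definable0_and n (S T : set (n.-tuple M)) :
  definable0 S -> definable0 T -> definable0 [set x | S x /\ T x].
Proof. by move=> [phi ->] [psi ->]; exists (FAnd phi psi). Qed.

Lemma definable0_ex k n (S : set ((k + n).-tuple M)) :
  definable0 S -> definable0 [set x | exists y : k.-tuple M, S (tcat y x)].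
Proof.
elim: k S => [|k IH] S [phi defS].
  exists phi; rewrite -defS; apply/seteqP; split=> x /=.
    case=> y; rewrite (tuple0 y).
    by have -> : tcat [tuple] x = x by apply: val_inj.
  by move=> Sx; exists [tuple]; have -> : tcat [tuple] x = x by apply: val_inj.
have /IH [psi defS'] : definable0
    [set w : (k + n).-tuple M | exists a : M, S [tuple of a :: w]].
  by exists (FEx phi); rewrite defS.
exists psi; rewrite -defS'; apply/seteqP; split=> x /= [y].
  case/tupleP: y => a y Sy; exists y, a.
  by have -> : [tuple of a :: tcat y x] = tcat [tuple of a :: y] x
    by apply: val_inj.
case=> a Sy; exists [tuple of a :: y].
by have <- : [tuple of a :: tcat y x] = tcat [tuple of a :: y] x
  by apply: val_inj.
Qed.

Lemma graphP (X Y : Type) p q (c : X -> p.-tuple M) (d : Y -> q.-tuple M)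
    (f : X -> Y) u v :
  graph c d f (tcat u v) <-> exists x, c x = u /\ d (f x) = v.
Proof.
split; first by case=> x _ /tcat_inj[<- <-]; exists x.
by case=> x [<- <-]; exists x.
Qed.

Lemma definable0_graph_comp (X Y W : Type) p q r (c : X -> p.-tuple M)
    (d : Y -> q.-tuple M) (e : W -> r.-tuple M) (f : X -> Y) (g : Y -> W) :
  injective d ->
  definable0 (graph c d f) -> definable0 (graph d e g) ->
  definable0 (graph c e (fun x => g (f x))).
Proof.
move=> injd deff defg.
have -> : graph c e (fun x => g (f x)) =
    [set w | exists u : q.-tuple M,
       graph c d f (tcat (tlsub w) u) /\ graph d e g (tcat u (trsub w))].
  apply/seteqP; split=> w /=.
    case=> x _ <-; exists (d (f x)); rewrite tlsubE trsubE.
    by split; apply/graphP; [exists x|exists (f x)].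
  case=> u [/graphP[x [cx du]] /graphP[y [dy ey]]].
  exists x => //; rewrite -[RHS]tcat_sub cx -ey.
  by move: dy; rewrite -du => /injd ->.
pose T := [set w : (q + (p + r)).-tuple M |
  graph c d f (tcat (tlsub (trsub w)) (tlsub w)) /\
  graph d e g (tcat (tlsub w) (trsub (trsub w)))].
have /definable0_ex : definable0 T.
  by apply: definable0_and; apply: definable0_preim => //;
    do ?[apply: selection_cat | apply: selection_l
                 | apply: selection_r | apply: selection_id].
congr definable0; apply/seteqP; split=> w [u Hu]; exists u; move: Hu;
  by rewrite /T /= !trsubE !tlsubE.
Qed.

Lemma definable0_graph_pair (X Y Y' : Type) p q q' (c : X -> p.-tuple M)
    (d : Y -> q.-tuple M) (d' : Y' -> q'.-tuple M) (f : X -> Y) (g : X -> Y') :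
  injective c ->
  definable0 (graph c d f) -> definable0 (graph c d' g) ->
  definable0 (graph c (fun y => tcat (d y.1) (d' y.2)) (fun x => (f x, g x))).
Proof.
move=> injc deff defg.
pose T := [set w : (p + (q + q')).-tuple M |
  graph c d f (tcat (tlsub w) (tlsub (trsub w))) /\
  graph c d' g (tcat (tlsub w) (trsub (trsub w)))].
have : definable0 T.
  by apply: definable0_and; apply: definable0_preim => //;
    do ?[apply: selection_cat | apply: selection_l
                 | apply: selection_r | apply: selection_id].
congr definable0; apply/seteqP; split=> w; rewrite /T /=.
  case=> /graphP[x [cx du]] /graphP[x' [cx' ev]].
  exists x => //=; rewrite -[RHS]tcat_sub -(tcat_sub (trsub w)) cx du -ev.
  by move: cx'; rewrite -cx => /injc ->.
case=> x _ <-; rewrite !trsubE !tlsubE.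
by split; apply/graphP; exists x.
Qed.

Lemma definable0_graph_prod (X X' Y Y' : Type) p p' q q' (c : X -> p.-tuple M)
    (c' : X' -> p'.-tuple M) (d : Y -> q.-tuple M) (d' : Y' -> q'.-tuple M)
    (f : X -> Y) (g : X' -> Y') :
  definable0 (graph c d f) -> definable0 (graph c' d' g) ->
  definable0 (graph (fun x => tcat (c x.1) (c' x.2))
    (fun y => tcat (d y.1) (d' y.2)) (fun x => (f x.1, g x.2))).
Proof.
move=> deff defg.
pose T := [set w : ((p + p') + (q + q')).-tuple M |
  graph c d f (tcat (tlsub (tlsub w)) (tlsub (trsub w))) /\
  graph c' d' g (tcat (trsub (tlsub w)) (trsub (trsub w)))].
have : definable0 T.
  by apply: definable0_and; apply: definable0_preim => //;
    do ?[apply: selection_cat | apply: selection_l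
                 | apply: selection_r | apply: selection_id].
congr definable0; apply/seteqP; split=> w; rewrite /T /=.
  case=> /graphP[x [cx du]] /graphP[x' [cx' ev]].
  exists (x, x') => //=; rewrite -[RHS]tcat_sub -(tcat_sub (trsub w)).
  by rewrite -(tcat_sub (tlsub w)) cx cx' du ev.
case=> x _ <-; rewrite /= !(trsubE, tlsubE).
by split; apply/graphP; [exists x.1|exists x.2].
Qed.

Lemma coord_inj n (S : set (n.-tuple M)) : injective (@coord n S).
Proof. exact: val_inj. Qed.

Lemma coord2_inj n (S : set (n.-tuple M)) : injective (@coord2 n S).
Proof. by move=> [x y] [x' y'] /tcat_inj[/coord_inj /= -> /coord_inj /= ->]. Qed.

End Definability.

Record dgroup (M : structure) (n : nat) := DGroup {
  dg_car : set (n.-tuple M);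
  dg_mul : dg_car * dg_car -> dg_car;
  dg_one : dg_car;
  dg_inv : dg_car -> dg_car;
  dg_mulA : associative (fun x y => dg_mul (x, y));
  dg_1mul : left_id dg_one (fun x y => dg_mul (x, y));
  dg_mul1 : right_id dg_one (fun x y => dg_mul (x, y));
  dg_Vmul : left_inverse dg_one dg_inv (fun x y => dg_mul (x, y));
  dg_mulV : right_inverse dg_one dg_inv (fun x y => dg_mul (x, y));
  dg_car_def : definable0 dg_car;
  dg_mul_def : definable0_fun2 dg_mul }.

Definition dg_sort M n (G : dgroup M n) : Type := dg_car G.
Coercion dg_sort : dgroup >-> Sortclass.

HB.instance Definition _ M n (G : dgroup M n) :=
  Choice.copy (dg_sort G) (set_type (dg_car G)).
HB.instance Definition _ M n (G : dgroup M n) :=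
  isGroup.Build (dg_sort G) (@dg_mulA M n G) (@dg_1mul M n G)
    (@dg_mul1 M n G) (@dg_Vmul M n G) (@dg_mulV M n G).

Record dhom (M : structure) n m (G : dgroup M n) (H : dgroup M m) := DHom {
  dh_fun :> {multiplicative G -> H};
  dh_def : definable0_fun dh_fun }.

Definition is_inclusion M n (A B : dgroup M n) (i : A -> B) : Prop :=
  forall a : A, coord (i a : dg_car B) = coord (a : dg_car A).

Definition finite_index (G : groupType) (H : set G) : Prop :=
  finite_set (range (fun x : G => [set (x * h)%g | h in H])).

Definition definably_connected M n (G : dgroup M n) : Prop :=
  forall H : set G,
    group_closed (mem H) -> definable [set coord (x : dg_car G) | x in H] ->
    finite_index H -> H = setT.

Definition short_exact (A B C : groupType) (i : A -> B) (b : B -> C) : Prop :=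
  [/\ injective i, range i = b @^-1` [set 1%g] & range b = setT].

Record dfabgroup (M : structure) (k : nat) := DFabGroup {
  fab_group : dgroup M k;
  fab_mulC : forall x y : fab_group, (x * y = y * x)%g;
  fab_finite : finite_set (dg_car fab_group) }.

(* [fab_sort Z] is the underlying set of Z with its group law written
   additively. *)
Definition fab_sort M k (Z : dfabgroup M k) : Type := dg_car (fab_group Z).
Coercion fab_sort : dfabgroup >-> Sortclass.

HB.instance Definition _ M k (Z : dfabgroup M k) :=
  Choice.copy (fab_sort Z) (set_type (dg_car (fab_group Z))).
HB.instance Definition _ M k (Z : dfabgroup M k) :=
  GRing.isZmodule.Build (fab_sort Z)
    (@mulgA (fab_group Z)) (@fab_mulC M k Z) (@mul1g (fab_group Z))
    (@mulVg (fab_group Z)).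

Lemma definable0_fab_sub M k (Z : dfabgroup M k) :
  definable0_fun2 (fun x : Z * Z => x.1 - x.2 : Z).
Proof.
pose p (w : ((k + k) + k).-tuple M) :=
  tcat (tcat (trsub w) (trsub (tlsub w))) (tlsub (tlsub w)).
have /(definable0_preim (p := p)) H := dg_mul_def (fab_group Z).
have {}H := H ltac:(do ?[apply: selection_cat | apply: selection_l
                 | apply: selection_r | apply: selection_id]).
congr definable0: H; rewrite /p; apply/seteqP; split=> w /=.
  case/graphP=> -[z v] [/tcat_inj/= [cz cv] cu].
  exists ((z : Z) + (v : Z), v : Z) => //; rewrite /= addrK /coord2 /=.
  rewrite -[RHS]tcat_sub -(tcat_sub (tlsub w)) -cz -cv; congr (tcat (tcat _ _) _).
  by rewrite -cu.
case=> -[u v] _ <-; rewrite !(trsubE, tlsubE).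
have E : (u : Z) - (v : Z) + (v : Z) = u := subrK (v : Z) (u : Z).
apply/graphP; exists ((u : Z) - (v : Z), v : Z); split=> //=.
by congr coord; exact: E.
Qed.

Lemma definable0_sub M k (Z : dfabgroup M k) X p (c : X -> p.-tuple M)
    (f g : X -> Z) :
  injective c ->
  definable0 (graph c (@coord M k (dg_car (fab_group Z))) f) ->
  definable0 (graph c (@coord M k (dg_car (fab_group Z))) g) ->
  definable0 (graph c (@coord M k (dg_car (fab_group Z))) (f - g)).
Proof.
move=> injc deff defg.
have := definable0_graph_pair injc deff defg.
move=> /definable0_graph_comp => /(_ _ _ _ _ (@coord2_inj M k _)
  (definable0_fab_sub Z)).
exact.
Qed.

Lemma definable0_0 M k (Z : dfabgroup M k) X p (c : X -> p.-tuple M) :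
  definable0 (range c) ->
  definable0 (graph c (@coord M k (dg_car (fab_group Z))) (0 : X -> Z)).
Proof.
move=> defc.
have := dg_mul_def (fab_group Z) => defm.
pose T := [set w : (p + k).-tuple M | range c (tlsub w) /\
  graph (@coord2 M k _) (@coord M k _) (@dg_mul M k (fab_group Z))
    (tcat (tcat (trsub w) (trsub w)) (trsub w))].
have : definable0 T.
  by apply: definable0_and; apply: definable0_preim => //;
    do ?[apply: selection_cat | apply: selection_l
                 | apply: selection_r | apply: selection_id].
congr definable0; apply/seteqP; split=> w; rewrite /T /=.
  case=> -[x _ cx] /graphP[[u v] [/tcat_inj/= [cu cv] cz]].
  exists x => //; rewrite -[RHS]tcat_sub cx -cu; congr (tcat _ (coord _)).
  have uv : u = v by apply: coord_inj; rewrite cu cv.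
  have : (u : Z) + (v : Z) = u by apply: (@coord_inj M k _); rewrite cu -cz.
  by rewrite -uv => /eqP; rewrite -subr_eq0 addrK => /eqP ->.
case=> x _ <-; rewrite !(trsubE, tlsubE); split; first by exists x.
apply/graphP; exists ((0 : Z), (0 : Z)); split=> //.
by congr coord; exact: (@addr0 Z 0).
Qed.

Lemma definable0_range_coord M n (G : dgroup M n) :
  definable0 (range (@coord M n (dg_car G))).
Proof.
have := dg_car_def G; congr definable0; apply/seteqP; split=> x /=.
  by move=> Gx; exists (exist _ x (mem_set Gx)).
by case=> -[y Gy] _ <-; exact: set_mem.
Qed.

Lemma definable0_range_coord2 M n (G : dgroup M n) :
  definable0 (range (@coord2 M n (dg_car G))).
Proof.
have defG := definable0_range_coord G.
pose T := [set w : (n + n).-tuple M |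
  range (@coord M n (dg_car G)) (tlsub w) /\
  range (@coord M n (dg_car G)) (trsub w)].
have : definable0 T.
  by apply: definable0_and; apply: definable0_preim => //;
    do ?[apply: selection_cat | apply: selection_l
                 | apply: selection_r | apply: selection_id].
congr definable0; apply/seteqP; split=> w; rewrite /T /=.
  case=> -[x _ cx] [y _ cy]; exists (x, y) => //.
  by rewrite -[RHS]tcat_sub -cx -cy.
by case=> -[x y] _ <-; rewrite trsubE tlsubE; split; [exists x|exists y].
Qed.

Section Cohomology.
Variables (M : structure) (n k : nat) (G : dgroup M n) (Z : dfabgroup M k).

Definition is_cocycle (f : G * G -> Z) : Prop :=
  (forall x : G, f (x, 1%g) = 0 /\ f (1%g, x) = 0) /\
  (forall x y z : G, f (x, y) + f ((x * y)%g, z) = f (x, (y * z)%g) + f (y, z)).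

Definition coboundary (h : G -> Z) (p : G * G) : Z :=
  h (p.1 * p.2)%g - h p.1 - h p.2.

Definition Z2_pred : {pred G * G -> Z} :=
  fun f => `[< is_cocycle f /\ definable0_fun2 f >].

Lemma Z2_predP f :
  reflect (is_cocycle f /\ definable0_fun2 f) (f \in Z2_pred).
Proof. exact: asboolP. Qed.

Lemma Z2_zmod_closed : zmod_closed Z2_pred.
Proof.
split.
  apply/asboolP; split; first by split=> // x y z; rewrite !addr0.
  exact/definable0_0/definable0_range_coord2.
move=> f g /asboolP[[f1 fc] deff] /asboolP[[g1 gc] defg].
apply/asboolP; split; last exact: (definable0_sub (@coord2_inj M n _)).
split=> [x|x y z].
  by rewrite !fctE; have [-> ->] := f1 x; have [-> ->] := g1 x; rewrite subrr.
by rewrite !fctE addrACA -opprD fc gc opprD addrACA.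
Qed.

HB.instance Definition _ := GRing.isZmodClosed.Build _ Z2_pred Z2_zmod_closed.

Record Z2 := MkZ2 { Z2_fun : G * G -> Z; _ : Z2_fun \in Z2_pred }.

HB.instance Definition _ := [isSub for Z2_fun].
HB.instance Definition _ := [Choice of Z2 by <:].
HB.instance Definition _ := [SubChoice_isSubZmodule of Z2 by <:].

Definition B2_pred : {pred Z2} :=
  fun f => `[< exists h : G -> Z,
    [/\ h 1%g = 0, definable0_fun h & Z2_fun f = coboundary h] >].

Lemma B2_predP f :
  reflect (exists h : G -> Z,
    [/\ h 1%g = 0, definable0_fun h & Z2_fun f = coboundary h])
    (f \in B2_pred).
Proof. exact: asboolP. Qed.

Lemma B2_zmod_closed : zmod_closed B2_pred.
Proof.
split.
  apply/asboolP; exists 0; split=> //.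
    exact/definable0_0/definable0_range_coord.
  by apply/funext=> p; rewrite /coboundary /= !subr0.
move=> f g /asboolP[h [h1 defh fE]] /asboolP[h' [h'1 defh' gE]].
apply/asboolP; exists (h - h'); split.
- by rewrite !fctE h1 h'1 subrr.
- exact: (definable0_sub (@coord_inj M n _)).
apply/funext => p; rewrite [LHS](_ : _ = Z2_fun f p - Z2_fun g p) //.
rewrite fE gE /coboundary !fctE !opprD !opprK.
by rewrite addrACA [X in X + _ = _]addrACA.
Qed.

HB.instance Definition _ := GRing.isZmodClosed.Build Z2 B2_pred B2_zmod_closed.

Definition H2 := Quotient.quot B2_pred.
HB.instance Definition _ := GRing.Zmodule.on H2.
HB.instance Definition _ := EqQuotient.on H2.

Definition H2_class (f : Z2) : H2 := \pi f.

Lemma H2_class_is_zmod_morphism : zmod_morphism H2_class.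
Proof. by move=> f g; rewrite /H2_class !piE. Qed.

HB.instance Definition _ :=
  GRing.isZmodMorphism.Build Z2 H2 H2_class H2_class_is_zmod_morphism.

Lemma H2_classK (c : H2) : H2_class (repr c) = c.
Proof. exact: reprK. Qed.

Lemma H2_class_eq0 (f : Z2) : (H2_class f == 0) = (f \in B2_pred).
Proof.
by rewrite -(raddf0 H2_class) /H2_class -Quotient.idealrBE subr0.
Qed.

End Cohomology.

Section Pullback.
Variables (M : structure) (n m k : nat) (G : dgroup M n) (H : dgroup M m).
Variables (phi : dhom G H) (Z : dfabgroup M k).

Lemma dhom1 : phi 1%g = 1%g.
Proof. by apply: (@mulgI _ (phi 1%g)); rewrite -gmulfM !mulg1. Qed.

Definition cocycle_pull (f : H * H -> Z) (p : G * G) : Z :=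
  f (phi p.1, phi p.2).

Lemma cocycle_pull_subproof (f : Z2 H Z) :
  cocycle_pull (Z2_fun f) \in @Z2_pred M n k G Z.
Proof.
case: f => f /= /Z2_predP[[f1 fc] deff]; apply/Z2_predP; split.
  split=> [x|x y z]; rewrite /cocycle_pull /= ?dhom1 ?gmulfM; first exact: f1.
  exact: fc.
have defphi2 := definable0_graph_prod (dh_def phi) (dh_def phi).
exact: (definable0_graph_comp (@coord2_inj M m _) defphi2 deff).
Qed.

Definition Z2_pull (f : Z2 H Z) : Z2 G Z := MkZ2 (cocycle_pull_subproof f).

Lemma Z2_pull_is_zmod_morphism : zmod_morphism Z2_pull.
Proof. by move=> f g; apply: val_inj; apply/funext. Qed.

HB.instance Definition _ :=
  GRing.isZmodMorphism.Build (Z2 H Z) (Z2 G Z) Z2_pull Z2_pull_is_zmod_morphism.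

Lemma Z2_pull_B2 (f : Z2 H Z) :
  f \in @B2_pred M m k H Z -> Z2_pull f \in @B2_pred M n k G Z.
Proof.
move=> /B2_predP[h [h1 defh fE]]; apply/B2_predP.
exists (fun x => h (phi x)); split; first by rewrite dhom1.
  exact: (definable0_graph_comp (@coord_inj M m _) (dh_def phi) defh).
apply/funext=> p; rewrite [LHS]/= /cocycle_pull fE /coboundary /=.
by rewrite gmulfM.
Qed.

(* The map sending the class of f to the class of f o (phi x phi), see
   [H2_pull_class] for the independence of the representative. For phi surjective
   this is inflation; for phi the inclusion of a subgroup it is restriction. *)
Definition H2_pull (c : H2 H Z) : H2 G Z := H2_class (Z2_pull (repr c)).

Lemma H2_pull_class (f : Z2 H Z) :
  H2_pull (H2_class f) = H2_class (Z2_pull f).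
Proof.
apply/eqP; rewrite -subr_eq0 -!raddfB H2_class_eq0 Z2_pull_B2 //.
by rewrite -H2_class_eq0 raddfB /= H2_classK subrr.
Qed.

Lemma H2_pull_is_zmod_morphism : zmod_morphism H2_pull.
Proof.
move=> a b; rewrite -[a]H2_classK -[b]H2_classK -raddfB !H2_pull_class.
by rewrite !raddfB.
Qed.

HB.instance Definition _ :=
  GRing.isZmodMorphism.Build (H2 H Z) (H2 G Z) H2_pull H2_pull_is_zmod_morphism.

End Pullback.

Arguments H2_pull {M n m k G H} phi Z.

Definition exact_at (U V W : zmodType) (f : U -> V) (g : V -> W) : Prop :=
  range f = g @^-1` [set 0].

(* Main.v *)
(* Exactness at H^2_d(B,Z) usually goes through a section C -> B, which need not be
   definable here. Given f with f|AxA = dh, put F(b,a) = f(b,a) + h(a). Then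
   F(b,aa') = F(b,a) + F(ba,a'), so on each coset bA the function F(b, .) is
   determined up to a constant in Z. By o-minimality every definable colouring of a
   nonempty definable set by finitely many colours has one colour containing the
   germ of the set at its left end; choosing this colour on every coset gives a
   0-definable u : B -> Z with u(ba) = u(b) + F(b,a). The cocycle f' = f - du is then
   invariant under right translation of its second argument by A, so that f'( . ,b)
   is a definable homomorphism A -> Z, which is 0 because A is definably connected.
   Hence f' factors through C x C. *)
Require Import Defs.
From mathcomp Require Import all_boot all_order all_algebra.
From mathcomp Require Import mathcomp_extra boolp classical_sets functions.
From mathcomp Require Import cardinality.

Set Implicit Arguments.
Unset Strict Implicit.
Unset Printing Implicit Defensive.

Import Order.TTheory GRing.Theory.
Local Open Scope classical_set_scope.
Local Open Scope ring_scope.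

Ltac sel := do ?[apply: selection_cat | apply: selection_l
  | apply: selection_r | apply: selection_id].

(** * First-order definability without parameters, and generic germs *)

Section Definable.
Variable M : structure.

Definition fiber p n (S : set ((p + n).-tuple M)) (w : p.-tuple M) :
  set (n.-tuple M) := [set y | S (tcat w y)].

Lemma definableP n (S : set (n.-tuple M)) :
  definable S <-> exists p (a : p.-tuple M) T, definable0 T /\ S = fiber T a.
Proof.
split=> [[p [a [phi ->]]]|[p [a [T [[phi ->] ->]]]]]; last by exists p, a, phi.
by exists p, a, [set w | sat phi w]; split=> //; exists phi.
Qed.

Lemma eq_definable0 n (S T : set (n.-tuple M)) :
  (forall w, S w <-> T w) -> definable0 S -> definable0 T.
Proof. by move=> ST; have -> : S = T by apply/seteqP; split=> w /ST. Qed.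

Lemma definable0_not n (P : n.-tuple M -> Prop) :
  definable0 [set w | P w] -> definable0 [set w | ~ P w].
Proof. case=> phi E; exists (FNot phi).
by rewrite (_ : P = [set w | sat phi w]). Qed.

Lemma definable0_imp n (P Q : n.-tuple M -> Prop) :
  definable0 [set w | P w] -> definable0 [set w | Q w] ->
  definable0 [set w | P w -> Q w].
Proof.
move=> defP /definable0_not defQ.
have := definable0_not (definable0_and defP defQ).
apply: eq_definable0 => w; split=> [H p|H [p q]]; last exact/q/H.
by apply: contrapT => q; apply: H.
Qed.

Lemma definable0_exists k n (P : k.-tuple M -> n.-tuple M -> Prop) :
  definable0 [set v : (k + n).-tuple M | P (tlsub v) (trsub v)] ->
  definable0 [set w | exists y, P y w].
Proof.
move=> /definable0_ex; apply: eq_definable0 => w.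
by split=> -[y H]; exists y; move: H; rewrite /= tlsubE trsubE.
Qed.

Lemma definable0_forall k n (P : k.-tuple M -> n.-tuple M -> Prop) :
  definable0 [set v : (k + n).-tuple M | P (tlsub v) (trsub v)] ->
  definable0 [set w | forall y, P y w].
Proof.
move=> /definable0_not.
move=> /(definable0_exists (P := fun y w => ~ P y w))/definable0_not.
apply: eq_definable0 => w; split=> /= H; last by case.
by move=> y; apply: contrapT => K; apply: H; exists y.
Qed.

Lemma definable0_le n (p q : n.-tuple M -> 1.-tuple M) :
  selection p -> selection q ->
  definable0 [set w | (thead (p w) <= thead (q w))%O].
Proof.
move=> [r Hr] [s Hs].
exists (FNot (FLt (Var (s ord0)) (Var (r ord0)))); apply/seteqP.
by split=> w /=; rewrite /thead Hr Hs leNgt => /negP.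
Qed.

(* [gen X S] says that, coordinate by coordinate, [S] contains the germ of [X] at
   its left end; [gen X] is an ultrafilter of definable subsets of [X] which is
   definable uniformly in [X]. *)
Fixpoint gen n : set (n.-tuple M) -> set (n.-tuple M) -> Prop :=
  match n with
  | 0 => fun X S => X [tuple] /\ S [tuple]
  | n'.+1 => fun X S => exists x : 1.-tuple M,
      (exists t : n'.-tuple M, X (tcat x t)) /\
      forall y : 1.-tuple M, (thead y <= thead x)%O ->
        (exists t : n'.-tuple M, X (tcat y t)) ->
        gen (@fiber 1 n' X y) (@fiber 1 n' S y)
  end.

(** The threshold [x] in [gen] lies in the projection of [X], so the condition applies at [y = x]
    itself and the induction continues in that fiber. *)
Lemma gen_nonempty n (X S : set (n.-tuple M)) :
  gen X S -> exists t, X t /\ S t.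
Proof.
elim: n X S => [|n IH] X S /=; first by exists [tuple].
by case=> x [Xx /(_ x (lexx _) Xx)/IH[t Ht]]; exists (tcat x t).
Qed.

Lemma gen_sub n (X S T : set (n.-tuple M)) :
  (forall t, X t -> S t -> T t) -> gen X S -> gen X T.
Proof.
elim: n X S T => [|n IH] X S T sub /=; first by case=> *; split=> //; exact: sub.
case=> x [Xx H]; exists x; split=> // y yx Xy.
by apply: IH (H y yx Xy) => t; apply: sub.
Qed.

(** In each coordinate the smaller of the two thresholds serves for both sets. *)
Lemma gen_and n (X S T : set (n.-tuple M)) :
  gen X S -> gen X T -> gen X [set t | S t /\ T t].
Proof.
elim: n X S T => [|n IH] X S T /=; first by case=> ? ? [].
case=> x [Xx Hx] [y [Xy Hy]].
have [xy|yx] := leP (thead x) (thead y); [exists x | exists y]; split=> // z zx Xz.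
  exact: IH (Hx z zx Xz) (Hy z (le_trans zx xy) Xz).
exact: IH (Hx z (le_trans zx (ltW yx)) Xz) (Hy z zx Xz).
Qed.

(** Induction on [n] for all [p] at once: passing to a fiber turns the leading coordinate into one
    more parameter, and the remaining clauses of [gen] are first-order in the order. *)
Lemma definable0_gen p n (X S : set ((p + n).-tuple M)) :
  definable0 X -> definable0 S ->
  definable0 [set w | gen (fiber X w) (fiber S w)].
Proof.
elim: n p X S => [|n IH] p X S defX defS.
  have sel0 : selection (fun w : p.-tuple M => tcat w [tuple]).
    apply: selection_cat; first exact: selection_id.
    by exists (widen_ord (leq0n p)) => w [].
  by apply: definable0_and; apply: definable0_preim.
(* A quantified tuple is placed in front, so [x] precedes the parameters [w]; [r] restores the order
   [w], [x], [t] expected by [X] and [S]. *)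
pose r (u : ((1 + p) + n).-tuple M) : (p + (1 + n)).-tuple M :=
  tcat (trsub (tlsub u)) (tcat (tlsub (tlsub u)) (trsub u)).
have selr : selection r by sel.
have rE x w (t : n.-tuple M) : r (tcat (tcat x w) t) = tcat w (tcat x t).
  by rewrite /r !(tlsubE, trsubE).
have defX' : definable0 [set u | X (r u)] by exact: definable0_preim.
have defS' : definable0 [set u | S (r u)] by exact: definable0_preim.
have defE q (f : q.-tuple M -> (1 + p).-tuple M) : selection f ->
  definable0 [set w | exists t, X (r (tcat (f w) t))].
  move=> self; apply: definable0_exists.
  apply: (definable0_preim (p := fun v => tcat (f (trsub v)) (tlsub v)) _ defX').
  apply: selection_cat; last by sel.
  case: self => g Hg; exists (fun i => rshift _ (g i)) => w i.
  by rewrite Hg tnth_mktuple.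
have gen_r x w : gen (@fiber 1 n (@fiber p (1 + n) X w) x)
    (@fiber 1 n (@fiber p (1 + n) S w) x) =
  gen (fiber [set u | X (r u)] (tcat x w)) (fiber [set u | S (r u)] (tcat x w)).
  by rewrite /fiber; congr gen; apply/seteqP; split=> t; rewrite /= rE.
suff : definable0 [set w | exists x, (exists t, X (r (tcat (tcat x w) t))) /\
    forall y : 1.-tuple M, (thead y <= thead x)%O ->
      (exists t, X (r (tcat (tcat y w) t))) ->
      gen (fiber [set u | X (r u)] (tcat y w)) (fiber [set u | S (r u)] (tcat y w))].
  apply: eq_definable0 => w; split=> -[x [[t Xt] H]]; exists x; split.
  - by exists t; move: Xt; rewrite rE.
  - move=> y yx [u Xu]; rewrite gen_r; apply: H => //.
    by exists u; rewrite rE.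
  - by exists t; rewrite rE.
  move=> y yx [u Xu]; rewrite -gen_r; apply: H => //.
  by exists u; move: Xu; rewrite rE.
apply: definable0_exists; apply: definable0_and.
  by apply: defE; sel.
apply: definable0_forall; apply: definable0_imp.
  by apply: definable0_le; sel.
apply: definable0_imp; first by apply: defE; sel.
apply: definable0_preim (IH _ _ _ defX' defS') => //.
by sel.
Qed.

(** * O-minimality: the germ decides every definable set *)

Lemma definable_fiber p n (X : set ((p + n).-tuple M)) w :
  definable X -> definable (fiber X w).
Proof.
move=> /definableP[q [a [T [defT ->]]]]; apply/definableP.
exists (q + p)%N, (tcat a w),
  [set v : ((q + p) + n).-tuple M |
    T (tcat (tlsub (tlsub v)) (tcat (trsub (tlsub v)) (trsub v)))].
split; first by apply: definable0_preim defT; sel.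
by apply/seteqP; split=> y; rewrite /fiber /= !(tlsubE, trsubE).
Qed.

Lemma definable_gen_fiber p n (X S : set ((p + n).-tuple M)) :
  definable X -> definable S ->
  definable [set w | gen (fiber X w) (fiber S w)].
Proof.
move=> /definableP[q [a [T [defT ->]]]] /definableP[q' [a' [T' [defT' ->]]]].
(* [X] and [S] may use different parameters; these are pooled as [(a, a')], from which [s] and [s']
   each select their own. *)
pose s (v : (((q + q') + p) + n).-tuple M) : (q + (p + n)).-tuple M :=
  tcat (tlsub (tlsub (tlsub v))) (tcat (trsub (tlsub v)) (trsub v)).
pose s' (v : (((q + q') + p) + n).-tuple M) : (q' + (p + n)).-tuple M :=
  tcat (trsub (tlsub (tlsub v))) (tcat (trsub (tlsub v)) (trsub v)).
have defs : definable0 [set v | T (s v)] by apply: definable0_preim defT; sel.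
have defs' : definable0 [set v | T' (s' v)]
  by apply: definable0_preim defT'; sel.
apply/definableP; exists (q + q')%N, (tcat a a'),
  [set w | gen (fiber [set v | T (s v)] w) (fiber [set v | T' (s' v)] w)].
split; first exact: definable0_gen defs defs'.
rewrite /fiber /=; apply/funext => w; congr gen; apply/funext => y /=;
  by rewrite /s /s' /= !(tlsubE, trsubE).
Qed.

(** Convexity of intervals: if [D] meets [i] arbitrarily far to the left, then to the left of one
    point of [D] in [i], each point of [D] lies between two points of [i], hence in [i]. *)
Lemma has_itv_germ (s : seq (interval M)) (D : set M) : D !=set0 ->
  exists2 x, D x &
    (forall y, (y <= x)%O -> D y -> has (fun i => y \in i) s) \/
    (forall y, (y <= x)%O -> D y -> ~~ has (fun i => y \in i) s).
Proof.
elim: s => [|i s IH] D0; first by case: D0 => x Dx; exists x => //; right.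
have [x Dx [Hx|Hx]] := IH D0.
  by exists x => //; left=> y yx Dy /=; rewrite Hx ?orbT.
(* Either [D] stays outside [i] from some [x'] downwards, or ([cof]) below each point of [D] up to
   [x] there is a point of [D] in [i]. *)
have [[x' [Dx' x'x Hx']]|H] := pselect (exists x', [/\ D x', (x' <= x)%O &
    forall y, (y <= x')%O -> D y -> y \notin i]).
  exists x' => //; right=> y yx' Dy /=; rewrite negb_or Hx' //=.
  by rewrite Hx // (le_trans yx').
have cof x' : D x' -> (x' <= x)%O -> exists y, [/\ (y <= x')%O, D y & y \in i].
  move=> Dx' x'x; apply: contrapT => K; apply: H; exists x'; split=> // y yx' Dy.
  by apply/negP => yi; apply: K; exists y.
have [x0 [x0x Dx0 x0i]] := cof x Dx (lexx _).
exists x0 => //; left=> y yx0 Dy /=.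
have [y' [y'y _ y'i]] := cof y Dy (le_trans yx0 x0x).
case: i {H cof Hx} y'i x0i => a b; rewrite !itv_boundlr => /andP[ay' _] /andP[_ x0b].
by rewrite (le_trans ay') ?bnd_simp // (le_trans _ x0b) ?bnd_simp.
Qed.

Hypothesis oM : o_minimal M.

Lemma definable_germ (D S : set (1.-tuple M)) : definable S -> D !=set0 ->
  exists2 x, D x &
    (forall y, (thead y <= thead x)%O -> D y -> S y) \/
    (forall y, (thead y <= thead x)%O -> D y -> ~ S y).
Proof.
case: oM => _ _ /[apply] -[s Hs] [x0 Dx0].
have sth (y : 1.-tuple M) : y = [tuple thead y].
  by case/tupleP: y => a t; apply: val_inj; rewrite (tuple0 t).
have [|x Dx H] := @has_itv_germ s [set x | D [tuple x]].
  by exists (thead x0); rewrite /= -sth.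
exists [tuple x] => //; case: H => H; [left|right] => y yx Dy.
  by rewrite (sth y); apply/Hs/H => //=; rewrite -sth.
by rewrite (sth y) => /Hs; apply/negP/H => //=; rewrite -sth.
Qed.

(** The first coordinates over which [S] is generic form a definable set, so by [definable_germ]
    they include all or none of the projection of [X] near its left end. In the second case the
    induction hypothesis makes the complement generic in each of these fibers. *)
Lemma gen_or_not n (X S : set (n.-tuple M)) :
  definable X -> definable S -> X !=set0 ->
  gen X S \/ gen X [set t | ~ S t].
Proof.
elim: n X S => [|n IH] X S defX defS [t Xt].
  have {}Xt : X [tuple] by rewrite -(tuple0 t).
  by have [?|?] := pselect (S [tuple]); [left|right].
have := @definable_germ [set x : 1.-tuple M | exists t : n.-tuple M, X (tcat x t)]
  _ (@definable_gen_fiber 1 n X S defX defS).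
case=> [|x Xx [H|H]].
- by exists [tuple thead t], [tuple of behead t]; congr X: Xt; apply: val_inj;
    case/tupleP: t => a u; rewrite /= theadE.
- by left; exists x.
right; exists x; split=> // y yx Xy.
have := IH _ _ (@definable_fiber 1 n X y defX) (@definable_fiber 1 n S y defS) Xy.
by case=> [gS|//]; case: (H y yx Xy).
Qed.

(** If no colour were generic, the finite intersection of their complements would be, and so would
    contain a point of [X] without colour. *)
Lemma gen_color n (I : choiceType) (X : set (n.-tuple M))
    (S : I -> set (n.-tuple M)) :
  finite_set [set: I] -> definable X -> (forall i, definable (S i)) ->
  X !=set0 -> (forall t, X t -> exists i, S i t) -> exists i, gen X (S i).
Proof.
move=> /finite_seqP[s sE] defX defS X0 cov.
suff [//|/gen_nonempty[t [Xt nS]]] : (exists i, gen X (S i)) \/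
    gen X [set t | forall i, i \in s -> ~ S i t].
  have [i Sit] := cov t Xt; case: (nS i) => //.
  by have : [set: I] i by []; rewrite sE.
elim: s {sE} => [|i s [IH|IH]]; [right|by left|].
  by have [] := gen_or_not defX defX X0; apply: gen_sub.
have [gS|gS] := gen_or_not defX (defS i) X0; first by left; exists i.
right; apply: gen_sub (gen_and gS IH) => t _ [nSi nS] j.
by rewrite inE => /predU1P[->|/nS].
Qed.

End Definable.

(** * Definable functions on quotients, homomorphisms to [Z], and coboundaries *)

Lemma graphE (M : structure) (X Y : Type) p q (c : X -> p.-tuple M)
    (d : Y -> q.-tuple M) (f : X -> Y) w :
  graph c d f w <-> exists x, c x = tlsub w /\ d (f x) = trsub w.
Proof. by rewrite -{1}[w]tcat_sub graphP. Qed.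

(** The section [s] is an arbitrary choice, but [u] is constant on the fibers of [f], so the graph
    of the induced map is the projection of the joint graph of [f] and [u], which does not involve
    [s]. *)
Lemma definable0_graph_factor (M : structure) (X Y W : Type) p q r
    (c : X -> p.-tuple M) (d : Y -> q.-tuple M) (e : W -> r.-tuple M)
    (f : X -> Y) (u : X -> W) :
  injective c -> (forall y, exists x, f x = y) ->
  (forall x x', f x = f x' -> u x = u x') ->
  definable0 (graph c d f) -> definable0 (graph c e u) ->
  exists2 v : Y -> W, definable0 (graph d e v) & forall x, u x = v (f x).
Proof.
move=> injc /choice[s sK] fu deff defu.
have uE x : u x = u (s (f x)) by apply: fu; rewrite sK.
exists (fun y => u (s y)) => //.
suff : definable0 [set w : (q + r).-tuple M | exists t,
    graph c d f (tcat t (tlsub w)) /\ graph c e u (tcat t (trsub w))].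
  apply: eq_definable0 => w /=; rewrite graphE; split.
    move=> [t [/graphP[x [<- <-]] /graphP[x' [/injc -> <-]]]].
    by exists (f x); rewrite -uE.
  case=> y [<- <-]; exists (c (s y)); rewrite !graphP.
  by split; exists (s y); rewrite ?sK.
by apply: definable0_exists; apply: definable0_and; apply: definable0_preim => //;
  sel.
Qed.

Section Groups.
Variables (M : structure) (n k : nat) (Z : dfabgroup M k).
Implicit Types G : dgroup M n.

Local Notation cZ := (@Defs.coord M k (dg_car (fab_group Z))).
Local Notation "c[ G ]" := (@Defs.coord M n (dg_car G)) (at level 8).

Lemma finite_fab : finite_set [set: Z].
Proof.
have -> : [set: Z] = cZ @^-1` (dg_car (fab_group Z)).
  by apply/seteqP; split=> // -[z hz] _; exact: set_mem hz.
apply: finite_preimage; last exact: fab_finite.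
by move=> x y _ _; exact: coord_inj.
Qed.

(** The left cosets of the kernel are fibers of [phi] and [Z] is finite, so the kernel is a
    definable subgroup of finite index. *)
Lemma connected_hom_trivial G (phi : G -> Z) :
  definably_connected G -> (forall x y : G, phi (x * y)%g = phi x + phi y) ->
  definable [set c[G] x | x in [set x | phi x = 0]] -> forall x, phi x = 0.
Proof.
move=> connG phiM defK x.
have phi1 : phi 1%g = 0 by apply: (@addrI _ (phi 1%g)); rewrite -phiM mulg1 addr0.
have phiV y : phi y^-1%g = - phi y.
  by apply/eqP; rewrite -addr_eq0 -phiM mulVg phi1.
suff : [set: G] `<=` [set x | phi x = 0] by exact.
rewrite (connG [set x | phi x = 0]) //.
  split; first by rewrite inE.
  by move=> y z; rewrite !inE /= phiM phiV => -> ->; rewrite subr0.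
apply: (@sub_finite_set _ _ [set [set y | phi y = z] | z in [set: Z]]); last first.
  exact/finite_image/finite_fab.
move=> _ [y _ <-]; exists (phi y) => //.
apply/seteqP; split=> [z /= zy|_ [h /= h0 <-] /=]; last first.
  by rewrite (phiM y h) h0 addr0.
by exists (y^-1 * z)%g; rewrite ?mulVKg //= (phiM y^-1%g z) phiV zy addNr.
Qed.

(** The value [u 1] is reached without parameters because the identity is the only solution of
    [t * t = t]. This serves to normalise functions at the identity. *)
Lemma definable0_const1 G (u : G -> Z) :
  definable0_fun u -> definable0_fun (fun _ : G => u 1%g).
Proof.
move=> defu.
suff : definable0 [set w : (n + k).-tuple M | range c[G] (tlsub w) /\ exists t,
    graph (@coord2 M n _) c[G] (@dg_mul M n G) (tcat (tcat t t) t) /\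
    graph c[G] cZ u (tcat t (trsub w))].
  apply: eq_definable0 => w /=; rewrite graphE; split.
    case=> -[x _ xE] [t [/graphP[[y y'] [/tcat_inj/=[yt y't] yy']]]].
    move=> /graphP[y'' [y''t uy]]; exists x; split=> //; rewrite -uy; congr (cZ (u _)).
    have yE : y' = y by apply: (@coord_inj M n); rewrite yt y't.
    have -> : y'' = y by apply: (@coord_inj M n); rewrite yt y''t.
    rewrite -yt yE in yy'; apply: (@mulgI G (y : G)); rewrite mulg1.
    exact/esym/(@coord_inj M n _ _ _ yy').
  case=> x [xE uE]; split; first by exists x.
  exists (c[G] (1%g : G)); rewrite !graphP; split; last by exists (1%g : G).
  by exists (1%g : G, 1%g : G); split=> //; congr (c[G] _); exact: (@mulg1 G).
apply: definable0_and.
  by apply: definable0_preim (definable0_range_coord G); sel.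
apply: definable0_exists; apply: definable0_and; apply: definable0_preim; sel.
  exact: dg_mul_def.
exact: defu.
Qed.

Lemma coboundary_Z2 G (h : G -> Z) :
  h 1%g = 0 -> definable0_fun h -> coboundary h \in @Z2_pred M n k G Z.
Proof.
move=> h1 defh; apply/Z2_predP; split.
  rewrite /coboundary; split=> [x|x y z] /=.
    by rewrite mulg1 mul1g h1 !subr0 !subrr.
  have cancel (a b c d e f : Z) : a - d - e + (b - a - f) = b - d - c + (c - e - f).
    rewrite addrC -(addrA a) -(addrA c) (addrAC b (- a)) !subrKA addrACA.
    by rewrite [- f - e]addrC.
  by rewrite mulgA; exact: cancel.
have -> : coboundary h = (fun p : G * G => h (dg_mul p)) - (fun p => h p.1)
    - (fun p => h p.2) by apply/funext=> -[].
have defG := definable0_range_coord G.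
apply: definable0_sub; first exact: coord2_inj.
  apply: definable0_sub; first exact: coord2_inj.
  - exact: (definable0_graph_comp (@coord_inj M n _) (dg_mul_def G) defh).
- suff : definable0 [set w : ((n + n) + k).-tuple M |
    graph c[G] cZ h (tcat (tlsub (tlsub w)) (trsub w)) /\
    range c[G] (trsub (tlsub w))].
    apply: eq_definable0 => w /=; rewrite [X in _ <-> X]graphE.
    rewrite -[tlsub w]tcat_sub !(tlsubE, trsubE) graphP.
    split; first by case=> -[x [<- <-]] [y _ <-]; exists (x, y).
    by case=> -[x y] [/tcat_inj/= [<- <-] <-]; split; [exists x|exists y].
  by apply: definable0_and; apply: definable0_preim => //; sel.
- suff : definable0 [set w : ((n + n) + k).-tuple M |
    graph c[G] cZ h (tcat (trsub (tlsub w)) (trsub w)) /\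
    range c[G] (tlsub (tlsub w))].
    apply: eq_definable0 => w /=; rewrite [X in _ <-> X]graphE.
    rewrite -[tlsub w]tcat_sub !(tlsubE, trsubE) graphP.
    split; first by case=> -[y [<- <-]] [x _ <-]; exists (x, y).
    by case=> -[x y] [/tcat_inj/= [<- <-] <-]; split; [exists y|exists x].
  by apply: definable0_and; apply: definable0_preim => //; sel.
Qed.

End Groups.

(** * Definable primitives along the cosets of [A] *)

Section Extension.
Variables (M : structure) (n k : nat) (Z : dfabgroup M k).
Variables (A B : dgroup M n) (iota : dhom A B).
Hypotheses (oM : o_minimal M) (incl : is_inclusion iota).

Local Notation cZ := (@Defs.coord M k (dg_car (fab_group Z))).
Local Notation "c[ G ]" := (@Defs.coord M n (dg_car G)) (at level 8).

Lemma inclusion_inj : injective iota.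
Proof.
by move=> a a' E; apply: (@coord_inj M n (dg_car A)); rewrite -!incl E.
Qed.

(* For b' in the coset [b A], b' = b a', the map [b a |-> F (b', a'^-1 a)] differs
   from [b a |-> F (b, a)] by the constant F (b, a'). So minus the generic value of
   this map on the coset is a primitive of [F]; no definable choice of coset
   representatives is needed. *)
Lemma definable0_primitive (F : B * A -> Z) :
  (forall (b : B) (a a' : A),
     F (b, (a * a')%g) = F (b, a) + F ((b * iota a)%g, a')) ->
  definable0 (graph (fun x : B * A => tcat (c[B] x.1) (c[A] x.2)) cZ F) ->
  exists h : B -> Z, [/\ h 1%g = 0, definable0_fun h &
    forall (b : B) (a : A), h (b * iota a)%g = h b + F (b, a)].
Proof.
move=> FM defF.
have defA := definable0_range_coord A; have defB := definable0_range_coord B.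
have defZ := definable0_range_coord (fab_group Z).
(* Over the parameters [(b, z)], the fiber of [X] is the coset [b A], and that of [S] is the part of
   it where [F (b, .)] has value [z]. *)
pose X := [set w : ((n + k) + n).-tuple M | exists t : n.-tuple M,
  range c[A] t /\ graph (@coord2 M n _) c[B] (@dg_mul M n B)
    (tcat (tcat (tlsub (tlsub w)) t) (trsub w))].
pose S := [set w : ((n + k) + n).-tuple M | exists t : n.-tuple M,
  graph (@coord2 M n _) c[B] (@dg_mul M n B)
    (tcat (tcat (tlsub (tlsub w)) t) (trsub w)) /\
  graph (fun x : B * A => tcat (c[B] x.1) (c[A] x.2)) cZ F
    (tcat (tcat (tlsub (tlsub w)) t) (trsub (tlsub w)))].
have defX : definable0 X.
  apply: definable0_exists; apply: definable0_and.
    by apply: definable0_preim defA; sel.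
  by apply: definable0_preim (dg_mul_def B); sel.
have defS : definable0 S.
  apply: definable0_exists; apply: definable0_and.
    by apply: definable0_preim (dg_mul_def B); sel.
  by apply: definable0_preim defF; sel.
have XE (b : B) (z : Z) :
    fiber X (tcat (c[B] b) (cZ z)) = [set c[B] (b * iota a)%g | a in [set: A]].
  apply/seteqP; split=> y; rewrite /fiber /X /= !(tlsubE, trsubE).
    move=> [_ [[a _ <-] /graphP[[b' a'] [/tcat_inj/=[/coord_inj <- a'E] <-]]]].
    exists a => //; move: a'E; rewrite -(incl a) => /coord_inj ->.
    by [].
  case=> a _ <-; exists (c[A] a); split; first by exists a.
  by apply/graphP; exists (b, iota a); rewrite /coord2 /= incl.
have SE (b : B) (z : Z) : fiber S (tcat (c[B] b) (cZ z)) =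
    [set c[B] (b * iota a)%g | a in [set a | F (b, a) = z]].
  apply/seteqP; split=> y; rewrite /fiber /S /= !(tlsubE, trsubE).
    move=> [t [/graphP[[b' a'] [/tcat_inj/=[/coord_inj <- a'E] <-]]]].
    move=> /graphP[[b'' a] [/tcat_inj/= [/coord_inj -> at_] /coord_inj Fz]].
    exists a => //; move: a'E; rewrite -at_ -(incl a) => /coord_inj ->.
    by [].
  case=> a Fz <-; exists (c[A] a); split.
    by apply/graphP; exists (b, iota a); rewrite /coord2 /= incl.
  by apply/graphP; exists (b, a); rewrite Fz.
pose isgen (b : B) (z : Z) :=
  gen (fiber X (tcat (c[B] b) (cZ z))) (fiber S (tcat (c[B] b) (cZ z))).
(* Two generic colours share a point [b a], and [b a] determines [a], hence the value [F (b, a)]. *)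
have isgen_uniq b z z' : isgen b z -> isgen b z' -> z = z'.
  rewrite /isgen !XE !SE => gz /(gen_and gz)/gen_nonempty[_ [_ [[a <- <-] []]]].
  by move=> a' <- /coord_inj/(@mulgI B b)/inclusion_inj ->.
have isgen_ex b : exists z, isgen b z.
  have defXb (z : Z) : definable (fiber X (tcat (c[B] b) (cZ z))).
    by apply/definableP; exists (n + k)%N, (tcat (c[B] b) (cZ z)), X.
  have defSb (z : Z) : definable (fiber S (tcat (c[B] b) (cZ z))).
    by apply/definableP; exists (n + k)%N, (tcat (c[B] b) (cZ z)), S.
  (* The fiber of [X] is the same for every [z]; the [0] here is a placeholder. *)
  have := gen_color oM (finite_fab Z) (defXb (0 : Z)) defSb.
  case=> [||z Hz]; last by exists z; move: Hz; rewrite /isgen !XE.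
  - by rewrite XE; exists (c[B] (b * iota 1)%g), (1%g : A).
  - by rewrite XE => _ [a _ <-]; exists (F (b, a)); rewrite SE; exists a.
(* The cosets of [b] and [b a] coincide, and so do the colour classes: by [FM], [F (b, a a') = z]
   exactly when [F (b a, a') = z - F (b, a)]. *)
have isgen_shift b (a : A) z : isgen b z -> isgen (b * iota a)%g (z - F (b, a)).
  rewrite /isgen !XE !SE; congr gen; apply/seteqP; split=> _ [a' /= Ha' <-].
  - exists (a^-1 * a')%g => //.
    by rewrite gmulfM mulgA -(mulgA b) -gmulfM mulgV dhom1 mulg1.
  - by exists (a * a')%g => //; rewrite gmulfM mulgA.
  - exists (a^-1 * a')%g => /=; last first.
      by rewrite gmulfM mulgA -(mulgA b) -gmulfM mulgV dhom1 mulg1.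
    apply: (@addrI _ (F (b, a))); rewrite -FM mulVKg Ha'.
    by rewrite addrC subrK.
  - exists (a * a')%g => /=; last by rewrite gmulfM mulgA.
    by rewrite FM Ha' addrC subrK.
have [h hgen] := choice isgen_ex.
have hM b (a : A) : h (b * iota a)%g = h b - F (b, a).
  exact: isgen_uniq (hgen _) (isgen_shift _ _ _ (hgen b)).
(* [h] comes from choice, but by uniqueness its graph is the set of [(b, z)] with [z] generic for
   [b]. *)
have defh : definable0_fun h.
  suff : definable0 [set w : (n + k).-tuple M | range c[B] (tlsub w) /\
      (range cZ (trsub w) /\ gen (fiber X w) (fiber S w))].
    apply: eq_definable0 => w; rewrite [X in _ <-> X]graphE -[w]tcat_sub /=.
    rewrite !(tlsubE, trsubE); split.
      case=> -[b _ <-] [[z _ <-] bz]; exists b; split=> //; congr cZ.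
      exact: isgen_uniq (hgen b) bz.
    case=> b [<- <-]; split; first by exists b.
    by split; [exists (h b)|exact: hgen].
  apply: definable0_and; first by apply: definable0_preim defB; sel.
  apply: definable0_and; first by apply: definable0_preim defZ; sel.
  exact: definable0_gen.
(* The sign turns the decrease in [hM] into an increase; the constant [h 1] gives value 0 at the
   identity. *)
exists ((fun _ : B => h 1%g) - h); split.
- by rewrite !fctE subrr.
- by apply: definable0_sub; [exact: coord_inj|exact: definable0_const1|].
- by move=> b a; rewrite !fctE hM opprB addrA addrAC.
Qed.

End Extension.

Lemma Z2_funP (M : structure) n k (G : dgroup M n) (Z : dfabgroup M k)
    (f : Z2 G Z) : is_cocycle (Z2_fun f) /\ definable0_fun2 (Z2_fun f).
Proof. by apply/Z2_predP; case: f. Qed.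

(** * Exactness of the inflation-restriction sequence *)

Section Exactness.
Variables (M : structure) (n m k : nat) (Z : dfabgroup M k).
Variables (A B : dgroup M n) (C : dgroup M m).
Variables (iota : dhom A B) (beta : dhom B C).
Hypotheses (oM : o_minimal M) (incl : is_inclusion iota).
Hypotheses (ex : short_exact iota beta) (connA : definably_connected A).

Local Notation cZ := (@Defs.coord M k (dg_car (fab_group Z))).
Local Notation "c[ G ]" := (@Defs.coord M n (dg_car G)) (at level 8).

Lemma beta_iota a : beta (iota a) = 1%g.
Proof.
case: ex => _ ker _; suff : (beta @^-1` [set 1%g]) (iota a) by [].
by rewrite -ker; exists a.
Qed.

Lemma beta_surj c : exists b, beta b = c.
Proof.
case: ex => _ _ im; have [b _ <-] : range beta c by rewrite im.
by exists b.
Qed.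

Lemma beta_eqP (b b' : B) : beta b = beta b' -> exists a, b' = (b * iota a)%g.
Proof.
move=> E; case: ex => _ ker _.
have [a _ aE] : range iota (b^-1 * b')%g.
  by rewrite ker; apply: (@mulgI C (beta b)); rewrite -gmulfM mulVKg mulg1.
by exists a; rewrite aE mulVKg.
Qed.

(** If the inflation of [g] is [dh], then [h] is additive on [A], where the inflation vanishes, so
    [h] is 0 there by connectedness. As [g (beta b, 1) = 0], [h] is then constant on the cosets of
    [A] and descends to a primitive of [g] on [C]. *)
Lemma inflation_injective : injective (H2_pull beta Z).
Proof.
suff H g : H2_pull beta Z g = 0 -> g = 0.
  move=> x y /eqP; rewrite -subr_eq0 -raddfB => /eqP/H/eqP.
  by rewrite subr_eq0 => /eqP.
rewrite -[g]H2_classK; move: (repr g) => {}g; rewrite H2_pull_class => /eqP.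
rewrite H2_class_eq0 => /B2_predP[h [h1 defh gh]]; apply/eqP; rewrite H2_class_eq0.
have ghE (b b' : B) : Z2_fun g (beta b, beta b') = h (b * b')%g - h b - h b'.
  by rewrite -[LHS]/(Z2_fun (Z2_pull beta g) (b, b')) gh.
have [[g1 gM] _] := Z2_funP g.
have hA a : h (iota a) = 0.
  apply: (@connected_hom_trivial M n k Z A (fun a => h (iota a))) => //.
    move=> x y; rewrite gmulfM; have := ghE (iota x) (iota y).
    rewrite !beta_iota (g1 1%g).1 => /esym/eqP.
    by rewrite subr_eq0 subr_eq => /eqP ->; rewrite addrC.
  have defhi := definable0_graph_comp (@coord_inj M n _) (dh_def iota) defh.
  apply/definableP; exists k, (cZ (0 : Z)),
    [set w : (k + n).-tuple M |
      graph c[A] cZ (fun a => h (iota a)) (tcat (trsub w) (tlsub w))].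
  split; first by apply: definable0_preim defhi; sel.
  apply/seteqP; split=> x; rewrite /fiber /= !(tlsubE, trsubE) graphP.
    by case=> a' ha <-; exists a'; rewrite ha.
  by case=> a' [<- /coord_inj ha]; exists a'.
have hbeta (b b' : B) : beta b = beta b' -> h b = h b'.
  move=> /beta_eqP[a ->]; apply/esym/eqP; rewrite -subr_eq0.
  have := ghE b (iota a); rewrite beta_iota (g1 (beta b)).1 hA subr0 => <-.
  by [].
have [u defu uE] := definable0_graph_factor (@coord_inj M n _) beta_surj hbeta
  (dh_def beta) defh.
apply/B2_predP; exists u; split=> //; first by rewrite -(dhom1 beta) -uE.
apply/funext=> -[c c']; have [b <-] := beta_surj c; have [b' <-] := beta_surj c'.
by rewrite ghE /coboundary /= -gmulfM -!uE.
Qed.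

Lemma inflation_restriction_exact :
  exact_at (H2_pull beta Z) (H2_pull iota Z).
Proof.
apply/seteqP; split=> [_ [g _ <-]|c] /=.
  rewrite -[g]H2_classK; move: (repr g) => {}g; rewrite !H2_pull_class.
  apply/eqP; rewrite H2_class_eq0; apply/B2_predP.
  have [[g1 gM] _] := Z2_funP g.
  (* The restricted inflation takes only the value [g (1, 1) = 0], so it is the coboundary of 0. *)
  exists 0; split=> //; first exact/definable0_0/definable0_range_coord.
  apply/funext=> -[a a']; rewrite /coboundary /= !subr0 /cocycle_pull /=.
  by rewrite /cocycle_pull /= !beta_iota (g1 1%g).1.
rewrite -[c]H2_classK; move: (repr c) => {c} f; rewrite H2_pull_class => /eqP.
rewrite H2_class_eq0 => /B2_predP[h [h1 defh fh]].
have fhE (a a' : A) : Z2_fun f (iota a, iota a') = h (a * a')%g - h a - h a'.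
  by rewrite -[LHS]/(Z2_fun (Z2_pull iota f) (a, a')) fh.
have [[f1 fM] deff] := Z2_funP f.
pose F (x : B * A) : Z := Z2_fun f (x.1, iota x.2) + h x.2.
have FM (b : B) (a a' : A) : F (b, (a * a')%g) = F (b, a) + F ((b * iota a)%g, a').
  (* The cocycle identity contributes the error [f (a, a')], which [h (a a') - h a - h a']
     cancels. *)
  rewrite /F /= addrACA fM fhE -gmulfM -addrA; congr (_ + _).
  by rewrite -[X in X + _]addrA -opprD subrK.
have defF : definable0
    (graph (fun x : B * A => tcat (c[B] x.1) (c[A] x.2)) cZ F).
  set c := fun x : B * A => _.
  have injc : injective c.
    by move=> [b a] [b' a'] /tcat_inj[/= /coord_inj -> /coord_inj ->].
  have def1 : definable0 (graph c cZ (fun x => Z2_fun f (x.1, iota x.2))).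
    suff : definable0 [set w : ((n + n) + k).-tuple M |
      range c[A] (trsub (tlsub w)) /\ graph (@coord2 M n _) cZ (Z2_fun f) w].
      apply: eq_definable0 => w /=; rewrite !graphE /c /coord2; split.
        move=> [[a _ aE] [[b b'] /= [bb' fz]]]; exists (b, a).
        have <- : b' = iota a.
          by apply: (@coord_inj M n); rewrite incl aE -bb' trsubE.
        by rewrite aE -bb' trsubE.
      case=> -[b a] /= [<- fz]; rewrite trsubE; split; first by exists a.
      by exists (b, iota a); rewrite /= incl.
    apply: definable0_and; last exact: deff.
    by apply: definable0_preim (definable0_range_coord A); sel.
  have def2 : definable0 (graph c cZ (fun x => h x.2)).
    suff : definable0 [set w : ((n + n) + k).-tuple M |
      range c[B] (tlsub (tlsub w)) /\
      graph c[A] cZ h (tcat (trsub (tlsub w)) (trsub w))].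
      apply: eq_definable0 => w /=; rewrite [X in _ <-> X]graphE graphP /c; split.
        move=> [[b _ bE] [a [aE ha]]]; exists (b, a).
        by rewrite /= bE aE tcat_sub.
      case=> -[b a] /= [<- hz]; rewrite !(trsubE, tlsubE).
      by split; [exists b|exists a].
    apply: definable0_and.
      by apply: definable0_preim (definable0_range_coord B); sel.
    by apply: definable0_preim defh; sel.
  (* Definability is available for differences, so the sum [p + q] is obtained as
     [p - ((p - p) - q)]. *)
  have := definable0_sub injc def1
    (definable0_sub injc (definable0_sub injc def1 def1) def2).
  congr (definable0 (graph _ _ _)); apply/funext => x.
  by rewrite !fctE subrr sub0r opprK.
have [u [u1 defu uM]] := definable0_primitive oM incl FM defF.
have [f' f'def] : exists f', f' = f - MkZ2 (coboundary_Z2 u1 defu) by eexists.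
have f'E (b b' : B) : Z2_fun f' (b, b') =
  Z2_fun f (b, b') - (u (b * b')%g - u b - u b') by rewrite f'def.
have [[f'1 f'M] deff'] := Z2_funP f'.
(* Expanding [u (b b' a)] and [u (b' a)] by [uM] produces [f (b b', a)], [f (b', a)] and two copies
   of [h a]; these cancel against the cocycle identity for [f] and each other. *)
have f'r (b b' : B) (a : A) : Z2_fun f' (b, (b' * iota a)%g) = Z2_fun f' (b, b').
  have fE : Z2_fun f (b, b' * iota a)%g =
      Z2_fun f (b, b') + Z2_fun f (b * b', iota a)%g - Z2_fun f (b', iota a).
    by rewrite fM addrK.
  have cancel (p q r x y z t : Z) :
      p + q - r - (x + (q + t) - y - (z + (r + t))) = p - (x - y - z).
    rewrite (addrAC x) (opprD z) addrACA (opprD r) (addrACA q) subrr addr0.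
    by rewrite -(addrA p) (opprD (x - y - z)) addrACA subrr addr0.
  by rewrite !f'E fE mulgA !uM cancel.
have f'A (a : A) (b : B) : Z2_fun f' (iota a, b) = 0.
  apply: (@connected_hom_trivial M n k Z A (fun a => Z2_fun f' (iota a, b))) => //.
    (* Additivity in the first argument: [f' (x, y) = f' (x, 1) = 0], and by normality [y b = b a']
       for some [a'] in [A], so [f' (x, y b) = f' (x, b)]. *)
    move=> x y; have := f'M (iota x) (iota y) b.
    rewrite gmulfM -[iota y]mul1g f'r (f'1 (iota x)).1 add0r mul1g => ->.
    have [|a' ->] := @beta_eqP b (iota y * b)%g; last by rewrite f'r.
    by rewrite gmulfM beta_iota mul1g.
  apply/definableP; exists (n + k)%N, (tcat (c[B] b) (cZ (0 : Z))),
    [set w : ((n + k) + n).-tuple M | range c[A] (trsub w) /\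
      graph (@coord2 M n _) cZ (Z2_fun f')
        (tcat (tcat (trsub w) (tlsub (tlsub w))) (trsub (tlsub w)))].
  split.
    apply: definable0_and.
      by apply: definable0_preim (definable0_range_coord A); sel.
    by apply: definable0_preim deff'; sel.
  apply/seteqP; split=> x; rewrite /fiber /= !(tlsubE, trsubE) graphP.
    case=> a' fa <-; split; first by exists a'.
    by exists (iota a', b); rewrite /coord2 /= incl fa.
  case=> -[a' _ <-] [[b1 b2] [/tcat_inj/=[]]].
  rewrite -incl => /coord_inj -> /coord_inj -> /coord_inj fa.
  by exists a'.
have f'beta (x y : B * B) : (beta x.1, beta x.2) = (beta y.1, beta y.2) ->
    Z2_fun f' x = Z2_fun f' y.
  case: x y => [b1 b2] [_ _] [] /= /beta_eqP[a ->] /beta_eqP[a' ->].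
  (* Invariance in the first argument: in the cocycle identity at [(b1, a, b2)] the terms
     [f' (b1, a)] and [f' (a, b2)] vanish, and [a b2] lies in the coset [b2 A]. *)
  rewrite f'r; have := f'M b1 (iota a) b2.
  rewrite -{1}[iota a]mul1g f'r (f'1 b1).1 add0r f'A addr0 => ->.
  have [|a'' ->] := @beta_eqP b2 (iota a * b2)%g; last by rewrite f'r.
  by rewrite gmulfM beta_iota mul1g.
have surj2 (y : C * C) : exists x : B * B, (beta x.1, beta x.2) = y.
  case: y => c c'; have [b <-] := beta_surj c; have [b' <-] := beta_surj c'.
  by exists (b, b').
have [g defg gE] := definable0_graph_factor (@coord2_inj M n _) surj2 f'beta
  (definable0_graph_prod (dh_def beta) (dh_def beta)) deff'.
have gZ2 : g \in @Z2_pred M m k C Z.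
  apply/Z2_predP; split=> //; split=> [c|c1 c2 c3].
    have [b <-] := beta_surj c; rewrite -(dhom1 beta).
    by rewrite -(gE (b, 1%g : B)) -(gE (1%g : B, b)).
  have [b1 <-] := beta_surj c1; have [b2 <-] := beta_surj c2.
  have [b3 <-] := beta_surj c3; rewrite -!gmulfM.
  by rewrite -(gE (b1, b2)) -(gE (_, b3)) -(gE (b1, _)) -(gE (b2, b3)).
exists (H2_class (MkZ2 gZ2)) => //; rewrite H2_pull_class.
apply/eqP; rewrite -subr_eq0 -raddfB H2_class_eq0 -rpredN opprB.
have -> : Z2_pull beta (MkZ2 gZ2) = f'.
  by apply: val_inj; apply/funext => x; rewrite [RHS]gE.
by apply/B2_predP; exists u; rewrite f'def opprB addrC subrK.
Qed.

End Exactness.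

Theorem theorem2 (M : structure) (n m : nat) (A B : dgroup M n)
    (C : dgroup M m) (iota : dhom A B) (beta : dhom B C) :
  o_minimal M ->
  is_inclusion iota ->
  short_exact iota beta ->
  definably_connected A ->
  forall (k : nat) (Z : dfabgroup M k),
    injective (H2_pull beta Z) /\ exact_at (H2_pull beta Z) (H2_pull iota Z).
Proof.
move=> oM incl ex connA k Z; split; first exact: inflation_injective ex connA.
exact: inflation_restriction_exact oM incl ex connA.
Qed.
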